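(* Let $\mathbb{F}$ be a field with $\mathrm{Char}(\mathbb{F})\neq 2,3$. With the algebras $A_1,\dots,A_{12}$ over $\mathbb{F}$ and the sets of matrices $Aut(A)$, $Der(A)$ as defined in the context, the following hold for all admissible values of the parameters. 1. $Aut(A_1(\alpha_1,\alpha_2,\alpha_4,\beta_1))=\{I\}$ and $Der(A_1(\alpha_1,\alpha_2,\alpha_4,\beta_1))=\{0\}$. 2. $Aut(A_2(\alpha_1,\alpha_4,\beta_2))=\{I\}$ and $Der(A_2(\alpha_1,\alpha_4,\beta_2))=\{0\}$. 3. If $\alpha_4\neq 0$: $Aut(A_3(\alpha_1,\alpha_4,\beta_2))=\left\{\begin{pmatrix}1&0\\0&\pm1\end{pmatrix}\right\}$ and $Der(A_3(\alpha_1,\alpha_4,\beta_2))=\{0\}$. If $\beta_2\neq 2\alpha_1-1$: $Aut(A_3(\alpha_1,0,\beta_2))=\left\{\begin{pmatrix}1&0\\0&d\end{pmatrix}: d\in\mathbb{F}, d\neq0\right\}$ and $Der(A_3(\alpha_1,0,\beta_2))=\left\{\begin{pmatrix}0&0\\0&d\end{pmatrix}: d\in\mathbb{F}\right\}$. $Aut(A_3(\alpha_1,0,2\alpha_1-1))=\left\{\begin{pmatrix}1&0\\c&d\end{pmatrix}: c,d\in\mathbb{F}, d\neq0\right\}$ and $Der(A_3(\alpha_1,0,2\alpha_1-1))=\left\{\begin{pmatrix}0&0\\c&d\end{pmatrix}: c,d\in\mathbb{F}\right\}$. 4. $Aut(A_4(\beta_1,\beta_2))=\{I\}$ and $Der(A_4(\beta_1,\beta_2))=\{0\}$.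 5. $Aut(A_5(\alpha_1))=\left\{\begin{pmatrix}1&0\\c&1\end{pmatrix}: c\in\mathbb{F}\right\}$ and $Der(A_5(\alpha_1))=\left\{\begin{pmatrix}0&0\\c&0\end{pmatrix}: c\in\mathbb{F}\right\}$. 6. $Aut(A_6(\alpha_1,\alpha_4))=\{I\}$ and $Der(A_6(\alpha_1,\alpha_4))=\{0\}$. 7. If $\alpha_4\neq0$: $Aut(A_7(\alpha_1,\alpha_4))=\left\{\begin{pmatrix}1&0\\0&\pm1\end{pmatrix}\right\}$ and $Der(A_7(\alpha_1,\alpha_4))=\{0\}$. If $\alpha_1\neq\frac13$: $Aut(A_7(\alpha_1,0))=\left\{\begin{pmatrix}1&0\\0&d\end{pmatrix}: d\in\mathbb{F}, d\neq0\right\}$ and $Der(A_7(\alpha_1,0))=\left\{\begin{pmatrix}0&0\\0&d\end{pmatrix}: d\in\mathbb{F}\right\}$. $Aut(A_7(\frac13,0))=\left\{\begin{pmatrix}1&0\\c&d\end{pmatrix}: c,d\in\mathbb{F}, d\neq0\right\}$ and $Der(A_7(\frac13,0))=\left\{\begin{pmatrix}0&0\\c&d\end{pmatrix}: c,d\in\mathbb{F}\right\}$. 8. $Aut(A_8(\beta_1))=\{I\}$ and $Der(A_8(\beta_1))=\{0\}$. 9. $Aut(A_9)=\left\{\begin{pmatrix}1&0\\c&1\end{pmatrix}: c\in\mathbb{F}\right\}$ and $Der(A_9)=\left\{\begin{pmatrix}0&0\\c&0\end{pmatrix}: c\in\mathbb{F}\right\}$. 10. If $\beta_1\neq0,4$: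 $Aut(A_{10}(\beta_1))=\{I\}\cup S_1\cup S_2$, where $$S_1=\left\{\begin{pmatrix}-1-d&-\frac{1+d+d^2}{1+2d}\\1+2d&d\end{pmatrix}: d\in\mathbb{F},\ 1+2d\neq0,\ d^2+d+1\neq0,\ \beta_1=\frac{(1+2d)^2}{d^2+d+1}\right\},$$ $$S_2=\left\{\begin{pmatrix}-d&\frac{-d-d^2}{1+2d}\\\frac{2d^2-d-1}{d}&d\end{pmatrix}: d\in\mathbb{F},\ d\neq0,\ 1+2d\neq0,\ \beta_1=\frac{(d-1)(1+2d)^2}{d^3}\right\},$$ and $Der(A_{10}(\beta_1))=\{0\}$. $Aut(A_{10}(0))=\left\{\begin{pmatrix}3a+1&a\\0&1\end{pmatrix}: a\in\mathbb{F}, 3a+1\neq0\right\}$ and $Der(A_{10}(0))=\left\{\begin{pmatrix}3a&a\\0&0\end{pmatrix}: a\in\mathbb{F}\right\}$. 11. If $\beta_1\neq0$: $Aut(A_{11}(\beta_1))=\left\{\begin{pmatrix}a&0\\0&a^2\end{pmatrix}: a\in\mathbb{F}, a^3=1\right\}\cup\left\{\begin{pmatrix}0&b\\1/b&0\end{pmatrix}: b\in\mathbb{F}, b\neq0, b^{-3}=\beta_1\right\}$ and $Der(A_{11}(\beta_1))=\{0\}$. $Aut(A_{11}(0))=\left\{\begin{pmatrix}a^2&b\\0&a\end{pmatrix}: a,b\in\mathbb{F}, a\neq0\right\}$ and $Der(A_{11}(0))=\left\{\begin{pmatrix}2a&b\\0&a\end{pmatrix}: a,b\in\mathbb{F}\right\}$.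 12. If $\beta_1\neq0$: $Aut(A_{12}(\beta_1))=\left\{\begin{pmatrix}\pm1&0\\0&1\end{pmatrix}\right\}\cup\left\{\begin{pmatrix}\frac{\varepsilon}{2}&b\\\frac{3\varepsilon}{4b}&-\frac12\end{pmatrix}: \varepsilon\in\{1,-1\},\ b\in\mathbb{F},\ b\neq0,\ \beta_1=\frac{3}{4b^2}\right\}$ and $Der(A_{12}(\beta_1))=\{0\}$. $Aut(A_{12}(0))=\left\{\begin{pmatrix}a&0\\0&1\end{pmatrix}: a\in\mathbb{F}, a\neq0\right\}$ and $Der(A_{12}(0))=\left\{\begin{pmatrix}a&0\\0&0\end{pmatrix}: a\in\mathbb{F}\right\}$.
   Context: An algebra over $\mathbb{F}$ is a vector space with a bilinear multiplication (no associativity, commutativity or unit is assumed). A two-dimensional algebra with a fixed basis $e=(e_1,e_2)$ is identified with its matrix of structure constants $$A=\begin{pmatrix}\alpha_1&\alpha_2&\alpha_3&\alpha_4\\\beta_1&\beta_2&\beta_3&\beta_4\end{pmatrix},$$ meaning $e_1e_1=\alpha_1e_1+\beta_1e_2$, $e_1e_2=\alpha_2e_1+\beta_2e_2$, $e_2e_1=\alpha_3e_1+\beta_3e_2$, $e_2e_2=\alpha_4e_1+\beta_4e_2$; equivalently $(eu)\cdot(ev)=eA(u\otimes v)$ for column vectors $u,v\in\mathbb{F}^2$, where $\otimes$ is the Kronecker product. A linear map is identified with its matrix in the basis $e$, acting on column coordinate vectors (columns are the coordinates of the images of $e_1,e_2$). An automorphism is an invertible linear map $\mathbf{g}$ with $\mathbf{g}(\mathbf{u}\cdot\mathbf{v})=\mathbf{g}(\mathbf{u})\cdot\mathbf{g}(\mathbf{v})$;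 a derivation is a linear map $\mathbf{D}$ with $\mathbf{D}(\mathbf{u}\cdot\mathbf{v})=\mathbf{D}(\mathbf{u})\cdot\mathbf{v}+\mathbf{u}\cdot\mathbf{D}(\mathbf{v})$. Thus $Aut(A)=\{g\in GL(2,\mathbb{F}): gA=A(g\otimes g)\}$ and $Der(A)=\{D\in Mat(2;\mathbb{F}): DA=A(D\otimes I+I\otimes D)\}$, where $I$ is the $2\times2$ identity matrix. $\mathbb{F}^*=\mathbb{F}\setminus\{0\}$. The algebras (for $\mathrm{Char}(\mathbb{F})\neq2,3$): - $A_1(\alpha_1,\alpha_2,\alpha_4,\beta_1)=\begin{pmatrix}\alpha_1&\alpha_2&1+\alpha_2&\alpha_4\\\beta_1&-\alpha_1&1-\alpha_1&-\alpha_2\end{pmatrix}$, $(\alpha_1,\alpha_2,\alpha_4,\beta_1)\in\mathbb{F}^4$; - $A_2(\alpha_1,\alpha_4,\beta_2)=\begin{pmatrix}\alpha_1&0&0&\alpha_4\\1&\beta_2&1-\alpha_1&0\end{pmatrix}$, $(\alpha_1,\alpha_4,\beta_2)\in\mathbb{F}^3$, $\alpha_4\in\mathbb{F}^*$; - $A_3(\alpha_1,\alpha_4,\beta_2)=\begin{pmatrix}\alpha_1&0&0&\alpha_4\\0&\beta_2&1-\alpha_1&0\end{pmatrix}$, $(\alpha_1,\alpha_4,\beta_2)\in\mathbb{F}^3$; - $A_4(\beta_1,\beta_2)=\begin{pmatrix}0&1&1&0\\\beta_1&\beta_2&1&-1\end{pmatrix}$, $(\beta_1,\beta_2)\in\mathbb{F}^2$;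 - $A_5(\alpha_1)=\begin{pmatrix}\alpha_1&0&0&0\\1&2\alpha_1-1&1-\alpha_1&0\end{pmatrix}$, $\alpha_1\in\mathbb{F}$; - $A_6(\alpha_1,\alpha_4)=\begin{pmatrix}\alpha_1&0&0&\alpha_4\\1&1-\alpha_1&-\alpha_1&0\end{pmatrix}$, $(\alpha_1,\alpha_4)\in\mathbb{F}^2$, $\alpha_4\in\mathbb{F}^*$; - $A_7(\alpha_1,\alpha_4)=\begin{pmatrix}\alpha_1&0&0&\alpha_4\\0&1-\alpha_1&-\alpha_1&0\end{pmatrix}$, $(\alpha_1,\alpha_4)\in\mathbb{F}^2$; - $A_8(\beta_1)=\begin{pmatrix}0&1&1&0\\\beta_1&1&0&-1\end{pmatrix}$, $\beta_1\in\mathbb{F}$; - $A_9=\begin{pmatrix}\frac13&0&0&0\\1&\frac23&-\frac13&0\end{pmatrix}$; - $A_{10}(\beta_1)=\begin{pmatrix}0&1&1&1\\\beta_1&0&0&-1\end{pmatrix}$, $\beta_1\in\mathbb{F}$; - $A_{11}(\beta_1)=\begin{pmatrix}0&0&0&1\\\beta_1&0&0&0\end{pmatrix}$, $\beta_1\in\mathbb{F}$; - $A_{12}(\beta_1)=\begin{pmatrix}0&1&1&0\\\beta_1&0&0&-1\end{pmatrix}$, $\beta_1\in\mathbb{F}$. *)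

(* Defs.v *)
From mathcomp Require Import all_boot all_algebra.
From mathcomp Require Import classical_sets mxtens.

Set Implicit Arguments.
Unset Strict Implicit.
Unset Printing Implicit Defensive.

Import GRing.Theory.

Local Open Scope classical_set_scope.
Local Open Scope ring_scope.

(* A matrix of structure constants has type 'M[F]_(2, 2 * 2): tensmx is the
   Kronecker product, and its index (i, j) has value i * 2 + j, so that the
   columns are the coordinates of e1 e1, e1 e2, e2 e1, e2 e2 in this order. *)
Definition scmx (F : fieldType) (a1 a2 a3 a4 b1 b2 b3 b4 : F) :
    'M[F]_(2, 2 * 2) :=
  \matrix_(i, j)
    (nth [::] [:: [:: a1; a2; a3; a4]; [:: b1; b2; b3; b4]] i)`_j.

Definition mx2 (F : fieldType) (a b c d : F) : 'M[F]_2 :=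
  \matrix_(i, j) (nth [::] [:: [:: a; b]; [:: c; d]] i)`_j.

Definition algAut (F : fieldType) (A : 'M[F]_(2, 2 * 2)) : set 'M[F]_2 :=
  [set g | g \in unitmx /\ g *m A = A *m tensmx g g].

Definition algDer (F : fieldType) (A : 'M[F]_(2, 2 * 2)) : set 'M[F]_2 :=
  [set D | D *m A = A *m (tensmx D 1%:M + tensmx 1%:M D)].

Definition A1 (F : fieldType) (alpha1 alpha2 alpha4 beta1 : F) :=
  scmx alpha1 alpha2 (1 + alpha2) alpha4
       beta1 (- alpha1) (1 - alpha1) (- alpha2).

Definition A2 (F : fieldType) (alpha1 alpha4 beta2 : F) :=
  scmx alpha1 0 0 alpha4
       1 beta2 (1 - alpha1) 0.

Definition A3 (F : fieldType) (alpha1 alpha4 beta2 : F) :=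
  scmx alpha1 0 0 alpha4
       0 beta2 (1 - alpha1) 0.

Definition A4 (F : fieldType) (beta1 beta2 : F) :=
  scmx 0 1 1 0
       beta1 beta2 1 (- 1).

Definition A5 (F : fieldType) (alpha1 : F) :=
  scmx alpha1 0 0 0
       1 (2 * alpha1 - 1) (1 - alpha1) 0.

Definition A6 (F : fieldType) (alpha1 alpha4 : F) :=
  scmx alpha1 0 0 alpha4
       1 (1 - alpha1) (- alpha1) 0.

Definition A7 (F : fieldType) (alpha1 alpha4 : F) :=
  scmx alpha1 0 0 alpha4
       0 (1 - alpha1) (- alpha1) 0.

Definition A8 (F : fieldType) (beta1 : F) :=
  scmx 0 1 1 0
       beta1 1 0 (- 1).

Definition A9 (F : fieldType) : 'M[F]_(2, 2 * 2) :=
  scmx (1 / 3) 0 0 0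
       1 (2 / 3) (- (1 / 3)) 0.

Definition A10 (F : fieldType) (beta1 : F) :=
  scmx 0 1 1 1
       beta1 0 0 (- 1).

Definition A11 (F : fieldType) (beta1 : F) :=
  scmx 0 0 0 1
       beta1 0 0 0.

Definition A12 (F : fieldType) (beta1 : F) :=
  scmx 0 1 1 0
       beta1 0 0 (- 1).

Definition S1 (F : fieldType) (beta1 : F) : set 'M[F]_2 :=
  [set g | exists d : F,
     [/\ 1 + 2 * d != 0, d ^+ 2 + d + 1 != 0,
         beta1 = (1 + 2 * d) ^+ 2 / (d ^+ 2 + d + 1)
       & g = mx2 (- 1 - d) (- ((1 + d + d ^+ 2) / (1 + 2 * d)))
                 (1 + 2 * d) d]].

Definition S2 (F : fieldType) (beta1 : F) : set 'M[F]_2 :=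
  [set g | exists d : F,
     [/\ d != 0, 1 + 2 * d != 0,
         beta1 = (d - 1) * (1 + 2 * d) ^+ 2 / d ^+ 3
       & g = mx2 (- d) ((- d - d ^+ 2) / (1 + 2 * d))
                 ((2 * d ^+ 2 - d - 1) / d) d]].

(* Main.v *)
Require Import Defs.
From mathcomp Require Import all_boot all_algebra.
From mathcomp Require Import classical_sets mxtens.
From mathcomp Require Import boolp ring.

(** In coordinates, an automorphism or derivation (a b; c d) is a solution of
    eight polynomial equations, two for each product of basis vectors
    ([algAut_mx2P], [algDer_mx2P]).  What makes them tractable is that the two
    linear forms u |-> tr (v |-> u v) and u |-> tr (v |-> v u) are intrinsic:
    an automorphism g satisfies L_(g u) = g L_u g^-1, so it fixes both forms,
    and a derivation D satisfies L_(D u) = [D, L_u], so it kills both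
    ([algAut_ltrace] and its three companions).

    In A1 the two forms are independent, hence g = 1 and D = 0 at once.  In
    A2, ..., A9 one of them is the first coordinate, which forces the first
    row of g to be (1 0) and that of D to be (0 0) ([algAut_row1],
    [algDer_row0]); only c and d remain.  All of these algebras except A4 and
    A8 have e1 e2 and e2 e1 on the line of e2, and for them the remaining
    equations become so short ([algAut_eigenP], [algDer_eigenP]) that the
    answer depends only on which of a4, b1, b2 + b3 - a1 vanish.

    A10, A11 and A12 are commutative with both trace forms zero, so they give
    no such reduction.  In A11 and A12 the equations contain products equal
    to zero, which split into cases directly.  A10 is the hard case.  A
    commutative algebra with zero trace forms is determined by the binary
    cubic form det (u, u u), here b x^3 - 3 x y^2 - y^3 with b for beta1.
    Automorphisms are the g with f (g u) = det g * f u; when the discriminant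
    is nonzero, that is when b is neither 0 nor 4, they permute the three
    roots of f faithfully.  So g <> 1 is a 3-cycle (trace -1, determinant 1)
    or an involution (trace 0, determinant -1).  The proof below finds these
    two values of the trace by elimination ([algAut_A10_trace]); the two sets
    S1 and S2 are then obtained by solving the equations for a given trace. *)

Set Implicit Arguments.
Unset Strict Implicit.
Unset Printing Implicit Defensive.

Import GRing.Theory.

Local Open Scope classical_set_scope.
Local Open Scope ring_scope.

(** Derives x = y from the certificate x - y = k (u - v).  Chained, followed by
    a call to ring, it checks that an equation is a linear combination of known
    ones. *)
Lemma eq_modulo (F : fieldType) (k u v x y : F) :
  u = v -> x - k * u = y - k * v -> x = y.
Proof. by move=> ->; apply: addIr. Qed.
Arguments eq_modulo {F} k {u v x y}.

Lemma natr_neq0 (F : fieldType) (p : nat) :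
  prime p -> p \notin [pchar F] -> p%:R != 0 :> F.
Proof. by move=> pr_p; rewrite inE pr_p. Qed.

(** * Structure equations in coordinates *)

Section StructureConstants.

Variable F : fieldType.
Implicit Types a b c d : F.

Lemma mx2_eta (g : 'M[F]_2) : g = mx2 (g 0 0) (g 0 1) (g 1 0) (g 1 1).
Proof.
apply/matrixP => -[[|[|//]] hi] [[|[|//]] hj]; rewrite mxE /=;
  by congr (g _ _); apply/val_inj.
Qed.

Lemma mx2_scalar1 : 1%:M = mx2 1 0 0 1 :> 'M[F]_2.
Proof. by rewrite [LHS]mx2_eta !mxE. Qed.

Lemma mx2_zero : 0 = mx2 0 0 0 0 :> 'M[F]_2.
Proof. by rewrite [LHS]mx2_eta !mxE. Qed.

Lemma det_mx2 a b c d : \det (mx2 a b c d) = a * d - b * c.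
Proof.
rewrite (expand_det_row _ 0) !big_ord_recl big_ord0 /cofactor !det_mx11 !mxE /=.
by ring.
Qed.

Lemma scmx_inj (x1 x2 x3 x4 y1 y2 y3 y4 z1 z2 z3 z4 t1 t2 t3 t4 : F) :
  scmx x1 x2 x3 x4 y1 y2 y3 y4 = scmx z1 z2 z3 z4 t1 t2 t3 t4 <->
  [/\ x1 = z1 /\ y1 = t1, x2 = z2 /\ y2 = t2, x3 = z3 /\ y3 = t3
    & x4 = z4 /\ y4 = t4].
Proof.
split=> [/matrixP E | [[-> ->] [-> ->] [-> ->] [-> ->]] //].
pose col k (lt_k : (k < 2 * 2)%N) := (E 0 (Ordinal lt_k), E 1 (Ordinal lt_k)).
by move: (col 0%N isT) (col 1%N isT) (col 2%N isT) (col 3%N isT);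
  rewrite /col !mxE /= => -[? ?] [? ?] [? ?] [? ?].
Qed.

Variables a1 a2 a3 a4 b1 b2 b3 b4 : F.
Local Notation A := (scmx a1 a2 a3 a4 b1 b2 b3 b4).

Lemma mul_mx2_scmx a b c d : mx2 a b c d *m A =
  scmx (a * a1 + b * b1) (a * a2 + b * b2) (a * a3 + b * b3) (a * a4 + b * b4)
       (c * a1 + d * b1) (c * a2 + d * b2) (c * a3 + d * b3) (c * a4 + d * b4).
Proof.
apply/matrixP => -[[|[|//]] ?] [[|[|[|[|//]]]] ?];
  by rewrite !mxE !big_ord_recl !big_ord0 !mxE /= addr0.
Qed.

Lemma algAut_mx2P a b c d : algAut A (mx2 a b c d) <->
  a * d - b * c != 0 /\
  [/\ a * a1 + b * b1 = a ^+ 2 * a1 + a * c * (a2 + a3) + c ^+ 2 * a4 /\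
      c * a1 + d * b1 = a ^+ 2 * b1 + a * c * (b2 + b3) + c ^+ 2 * b4,
      a * a2 + b * b2 = a * b * a1 + a * d * a2 + c * b * a3 + c * d * a4 /\
      c * a2 + d * b2 = a * b * b1 + a * d * b2 + c * b * b3 + c * d * b4,
      a * a3 + b * b3 = a * b * a1 + b * c * a2 + d * a * a3 + c * d * a4 /\
      c * a3 + d * b3 = a * b * b1 + b * c * b2 + d * a * b3 + c * d * b4
    & a * a4 + b * b4 = b ^+ 2 * a1 + b * d * (a2 + a3) + d ^+ 2 * a4 /\
      c * a4 + d * b4 = b ^+ 2 * b1 + b * d * (b2 + b3) + d ^+ 2 * b4].
Proof.
rewrite /algAut /= unitmxE unitfE det_mx2 mul_mx2_scmx -scmx_inj.
set C := scmx (_ + _ + _) _ _ _ _ _ _ _.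
have -> : A *m tensmx (mx2 a b c d) (mx2 a b c d) = C; last by [].
apply/matrixP => -[[|[|//]] ?] [[|[|[|[|//]]]] ?];
  by rewrite !mxE !big_ord_recl !big_ord0 !mxE /=; ring.
Qed.

Lemma algDer_mx2P a b c d : algDer A (mx2 a b c d) <->
  [/\ a * a1 + b * b1 = 2 * a * a1 + c * (a2 + a3) /\
      c * a1 + d * b1 = 2 * a * b1 + c * (b2 + b3),
      a * a2 + b * b2 = (a + d) * a2 + b * a1 + c * a4 /\
      c * a2 + d * b2 = (a + d) * b2 + b * b1 + c * b4,
      a * a3 + b * b3 = (a + d) * a3 + b * a1 + c * a4 /\
      c * a3 + d * b3 = (a + d) * b3 + b * b1 + c * b4
    & a * a4 + b * b4 = 2 * d * a4 + b * (a2 + a3) /\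
      c * a4 + d * b4 = 2 * d * b4 + b * (b2 + b3)].
Proof.
rewrite /algDer /= mul_mx2_scmx -scmx_inj.
set C := scmx (2 * _ * _ + _) _ _ _ _ _ _ _.
have -> : A *m (tensmx (mx2 a b c d) 1%:M + tensmx 1%:M (mx2 a b c d)) = C;
  last by [].
apply/matrixP => -[[|[|//]] ?] [[|[|[|[|//]]]] ?];
  by rewrite !mxE !big_ord_recl !big_ord0 !mxE /=; ring.
Qed.

(** * The invariant trace forms *)

(** Let M = g L_(e1) - L_(g e1) g.  Its entries are the differences of the two
    sides of the equations for the products e1 e1 and e1 e2, so M = 0, and
    tr (M adj g) = 0 says det g * tr L_(e1) = det g * tr L_(g e1).  The same
    with e2 in place of e1 uses e2 e1 and e2 e2.  The multipliers in the proof
    are the entries of the adjugate matrix. *)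
Lemma algAut_ltrace a b c d : algAut A (mx2 a b c d) ->
  (a1 + b2) * a + (a3 + b4) * c = a1 + b2 /\
  (a1 + b2) * b + (a3 + b4) * d = a3 + b4.
Proof.
move=> /algAut_mx2P[det_neq0 [[e00 e10] [e01 e11] [e02 e12] [e03 e13]]].
split; apply: (mulfI det_neq0).
  apply: (eq_modulo (- d) e00); apply: (eq_modulo c e01).
  by apply: (eq_modulo b e10); apply: (eq_modulo (- a) e11); ring.
apply: (eq_modulo (- d) e02); apply: (eq_modulo c e03).
by apply: (eq_modulo b e12); apply: (eq_modulo (- a) e13); ring.
Qed.

(** As [algAut_ltrace], for right multiplications: the columns of the operator
    now come from e1 e1 and e2 e1, respectively from e1 e2 and e2 e2. *)
Lemma algAut_rtrace a b c d : algAut A (mx2 a b c d) ->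
  (a1 + b3) * a + (a2 + b4) * c = a1 + b3 /\
  (a1 + b3) * b + (a2 + b4) * d = a2 + b4.
Proof.
move=> /algAut_mx2P[det_neq0 [[e00 e10] [e01 e11] [e02 e12] [e03 e13]]].
split; apply: (mulfI det_neq0).
  apply: (eq_modulo (- d) e00); apply: (eq_modulo c e02).
  by apply: (eq_modulo b e10); apply: (eq_modulo (- a) e12); ring.
apply: (eq_modulo (- d) e01); apply: (eq_modulo c e03).
by apply: (eq_modulo b e11); apply: (eq_modulo (- a) e13); ring.
Qed.

(** A commutator has trace zero, so the trace of D L_u - L_u D - L_(D u) = 0
    leaves tr L_(D u) = 0. *)
Lemma algDer_ltrace a b c d : algDer A (mx2 a b c d) ->
  (a1 + b2) * a + (a3 + b4) * c = 0 /\ (a1 + b2) * b + (a3 + b4) * d = 0.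
Proof.
move=> /algDer_mx2P[[e00 e10] [e01 e11] [e02 e12] [e03 e13]]; split.
  by apply: (eq_modulo (- 1) e00); apply: (eq_modulo (- 1) e11); ring.
by apply: (eq_modulo (- 1) e02); apply: (eq_modulo (- 1) e13); ring.
Qed.

Lemma algDer_rtrace a b c d : algDer A (mx2 a b c d) ->
  (a1 + b3) * a + (a2 + b4) * c = 0 /\ (a1 + b3) * b + (a2 + b4) * d = 0.
Proof.
move=> /algDer_mx2P[[e00 e10] [e01 e11] [e02 e12] [e03 e13]]; split.
  by apply: (eq_modulo (- 1) e00); apply: (eq_modulo (- 1) e12); ring.
by apply: (eq_modulo (- 1) e01); apply: (eq_modulo (- 1) e13); ring.
Qed.

(** One of the two trace forms is the first coordinate form (1 0). *)
Definition unit_trace :=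
  (a1 + b2 = 1 /\ a3 + b4 = 0) \/ (a1 + b3 = 1 /\ a2 + b4 = 0).

Lemma algAut_row1 a b c d :
  unit_trace -> algAut A (mx2 a b c d) -> a = 1 /\ b = 0.
Proof.
case=> -[t1 t2].
  by move=> /algAut_ltrace; rewrite t1 t2 !mul0r !mul1r !addr0.
by move=> /algAut_rtrace; rewrite t1 t2 !mul0r !mul1r !addr0.
Qed.

Lemma algDer_row0 a b c d :
  unit_trace -> algDer A (mx2 a b c d) -> a = 0 /\ b = 0.
Proof.
case=> -[t1 t2].
  by move=> /algDer_ltrace; rewrite t1 t2 !mul0r !mul1r !addr0.
by move=> /algDer_rtrace; rewrite t1 t2 !mul0r !mul1r !addr0.
Qed.

End StructureConstants.

(** * Algebras with e2 an eigenvector of both multiplications by e1 *)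

Section EigenFamily.

Variable F : fieldType.
Hypothesis two_neq0 : 2 != 0 :> F.
Variables a1 a4 b1 b2 b3 : F.
Hypothesis trace1 : a1 + b2 = 1 \/ a1 + b3 = 1.
Local Notation A := (scmx a1 0 0 a4 b1 b2 b3 0).

Lemma unit_trace_eigen : unit_trace a1 0 0 b2 b3 0.
Proof. by case: trace1 => ?; [left | right]; rewrite addr0. Qed.

(** Common form of A2, A3, A5, A6, A7 and A9.  With a = 1 and b = 0 forced by
    the trace form, e2 e2 = a4 e1 gives the conditions on a4, and e1 e1 gives
    the last one. *)
Lemma algAut_eigenP g : algAut A g <-> exists c d,
  [/\ d != 0, a4 * c = 0, a4 * (d ^+ 2 - 1) = 0,
      c * (b2 + b3 - a1) = (d - 1) * b1 & g = mx2 1 0 c d].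
Proof.
split=> [|[c [d [d_neq0 a4c a4d e ->]]]]; last first.
  apply/algAut_mx2P; split; first by rewrite mul1r mul0r subr0.
  split; split; first [ by apply: (eq_modulo (- c) a4c); ring
    | by apply: (eq_modulo (- d) a4c); ring
    | by apply: (eq_modulo (- 1) a4d); ring
    | by apply: (eq_modulo 1 a4c); ring | by apply: (eq_modulo (- 1) e); ring
    | by ring].
rewrite (mx2_eta g); move: (g 0 0) (g 0 1) (g 1 0) (g 1 1) => a b c d Ag.
have [a_eq1 b_eq0] := algAut_row1 unit_trace_eigen Ag.
move: Ag; rewrite a_eq1 b_eq0 => /algAut_mx2P.
move=> [d_neq0 [[_ e11] _ _ [e22 e22']]].
exists c, d; split=> //.
- by move: d_neq0; rewrite mul1r mul0r subr0.
- by apply: (eq_modulo 1 e22'); ring.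
- by apply: (eq_modulo (- 1) e22); ring.
- by apply: (eq_modulo (- 1) e11); ring.
Qed.

Lemma algDer_eigenP D : algDer A D <-> exists c d,
  [/\ a4 * c = 0, a4 * d = 0, c * (b2 + b3 - a1) = d * b1 & D = mx2 0 0 c d].
Proof.
split=> [|[c [d [a4c a4d e ->]]]]; last first.
  apply/algDer_mx2P.
  split; split; first [ by apply: (eq_modulo (- 2) a4d); ring
    | by apply: (eq_modulo (- 1) a4c); ring
    | by apply: (eq_modulo 1 a4c); ring | by apply: (eq_modulo (- 1) e); ring
    | by ring].
rewrite (mx2_eta D); move: (D 0 0) (D 0 1) (D 1 0) (D 1 1) => a b c d AD.
have [a_eq0 b_eq0] := algDer_row0 unit_trace_eigen AD.
move: AD; rewrite a_eq0 b_eq0 => /algDer_mx2P [[_ e11] _ _ [e22 e22']].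
exists c, d; split=> //.
- by apply: (eq_modulo 1 e22'); ring.
- by apply: (mulfI two_neq0); apply: (eq_modulo (- 1) e22); ring.
- by apply: (eq_modulo (- 1) e11); ring.
Qed.

(** In the next five lemmas the condition
    c (b2 + b3 - a1) = (d - 1) b1 decides: with a4 != 0 one has c = 0 and
    d = 1 or -1, and b1 = 1 excludes d = -1. *)
Lemma eigen_rigid : a4 != 0 -> b1 = 1 ->
  algAut A = [set 1%:M] /\ algDer A = [set 0].
Proof.
move=> a4_neq0 b1_eq1; split; apply/predeqP => g /=.
  rewrite mx2_scalar1 algAut_eigenP b1_eq1; split=> [|->].
    move=> [c [d [_ /eqP]]]; rewrite mulf_eq0 (negPf a4_neq0) /= => /eqP ->.
    by rewrite mul0r mulr1 => _ /esym/subr0_eq ->.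
  by exists 0, 1; split; rewrite ?oner_eq0 //; ring.
rewrite mx2_zero algDer_eigenP b1_eq1; split=> [|->].
  move=> [c [d [/eqP]]]; rewrite mulf_eq0 (negPf a4_neq0) /= => /eqP ->.
  by move=> _; rewrite mul0r mulr1 => <-.
by exists 0, 0; split=> //; ring.
Qed.

Lemma eigen_reflection : a4 != 0 -> b1 = 0 ->
  algAut A = [set mx2 1 0 0 1; mx2 1 0 0 (- 1)] /\ algDer A = [set 0].
Proof.
move=> a4_neq0 b1_eq0; split; apply/predeqP => g /=.
  rewrite algAut_eigenP b1_eq0; split=> [|[] ->].
  - move=> [c [d [_ /eqP]]]; rewrite mulf_eq0 (negPf a4_neq0) /= => /eqP ->.
    move=> /eqP; rewrite mulf_eq0 (negPf a4_neq0) /= subr_eq0 sqrf_eq1.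
    by move=> /orP[] /eqP -> _ ->; [left | right].
  - by exists 0, 1; split; rewrite ?oner_eq0 //; ring.
  - by exists 0, (- 1); split; rewrite ?oppr_eq0 ?oner_eq0 //; ring.
rewrite mx2_zero algDer_eigenP; split=> [|->].
  move=> [c [d [/eqP]]]; rewrite mulf_eq0 (negPf a4_neq0) /= => /eqP ->.
  by move=> /eqP; rewrite mulf_eq0 (negPf a4_neq0) /= => /eqP -> _.
by exists 0, 0; split=> //; ring.
Qed.

Lemma eigen_torus : a4 = 0 -> b1 = 0 -> b2 + b3 != a1 ->
  algAut A = [set g | exists d, d != 0 /\ g = mx2 1 0 0 d] /\
  algDer A = [set D | exists d, D = mx2 0 0 0 d].
Proof.
move=> a4_eq0 b1_eq0; rewrite -subr_eq0 => /mulIf b_inj.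
split; apply/predeqP => g /=.
  rewrite algAut_eigenP a4_eq0 b1_eq0; split=> [|[d [d_neq0 ->]]].
    move=> [c [d [d_neq0 _ _ e ->]]]; exists d; split=> //; congr mx2.
    by apply: b_inj; rewrite e mulr0 mul0r.
  by exists 0, d; split=> //; ring.
rewrite algDer_eigenP a4_eq0 b1_eq0; split=> [|[d ->]].
  move=> [c [d [_ _ e ->]]]; exists d; congr mx2.
  by apply: b_inj; rewrite e mulr0 mul0r.
by exists 0, d; split=> //; ring.
Qed.

Lemma eigen_affine : a4 = 0 -> b1 = 0 -> b2 + b3 = a1 ->
  algAut A = [set g | exists c d, d != 0 /\ g = mx2 1 0 c d] /\
  algDer A = [set D | exists c d, D = mx2 0 0 c d].
Proof.
move=> a4_eq0 b1_eq0 b_eq; split; apply/predeqP => g /=.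
  rewrite algAut_eigenP a4_eq0 b1_eq0 b_eq; split=> [|[c [d [d_neq0 ->]]]].
    by move=> [c [d [d_neq0 _ _ _ ->]]]; exists c, d.
  by exists c, d; split=> //; ring.
rewrite algDer_eigenP a4_eq0 b1_eq0 b_eq; split=> [|[c [d ->]]].
  by move=> [c [d [_ _ _ ->]]]; exists c, d.
by exists c, d; split=> //; ring.
Qed.

Lemma eigen_unipotent : a4 = 0 -> b1 = 1 -> b2 + b3 = a1 ->
  algAut A = [set g | exists c, g = mx2 1 0 c 1] /\
  algDer A = [set D | exists c, D = mx2 0 0 c 0].
Proof.
move=> a4_eq0 b1_eq1 b_eq; split; apply/predeqP => g /=.
  rewrite algAut_eigenP a4_eq0 b1_eq1 b_eq; split=> [|[c ->]].
    move=> [c [d [_ _ _ e ->]]]; exists c; congr mx2.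
    by apply: (eq_modulo (- 1) e); ring.
  by exists c, 1; split; rewrite ?oner_eq0 //; ring.
rewrite algDer_eigenP a4_eq0 b1_eq1 b_eq; split=> [|[c ->]].
  move=> [c [d [_ _ e ->]]]; exists c; congr mx2.
  by apply: (eq_modulo (- 1) e); ring.
by exists c, 0; split=> //; ring.
Qed.

End EigenFamily.

(** * The families A1, A4 and A8 *)

Section RigidFamilies.

Variable F : fieldType.
Hypothesis two_neq0 : 2 != 0 :> F.

Lemma algAut1 (A : 'M[F]_(2, 2 * 2)) : algAut A 1%:M.
Proof.
split; first exact: unitmx1.
suff -> : tensmx 1%:M 1%:M = 1%:M :> 'M[F]_(2 * 2) by rewrite mul1mx mulmx1.
apply/matrixP => i j; case: (mxtens_indexP i) => i0 i1.
case: (mxtens_indexP j) => j0 j1; rewrite tensmxE !mxE -natrM mulnb.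
by rewrite (can_eq (@mxtens_indexK _ _)).
Qed.

Lemma algDer0 (A : 'M[F]_(2, 2 * 2)) : algDer A 0.
Proof. by rewrite /algDer /= tens0mx tensmx0 addr0 mulmx0 mul0mx. Qed.

(** The left trace form is (0 1) and the right one is (1 0), and together they
    determine every entry. *)
Lemma A1_rigid (alpha1 alpha2 alpha4 beta1 : F) :
  algAut (A1 alpha1 alpha2 alpha4 beta1) = [set 1%:M] /\
  algDer (A1 alpha1 alpha2 alpha4 beta1) = [set 0].
Proof.
split; apply/predeqP => g /=; split=> [|->]; [|exact: algAut1| |exact: algDer0].
  rewrite (mx2_eta g) mx2_scalar1.
  move: (g 0 0) (g 0 1) (g 1 0) (g 1 1) => a b c d Ag.
  have [ec ed] := algAut_ltrace Ag; have [ea eb] := algAut_rtrace Ag.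
  congr mx2; [apply: (eq_modulo 1 ea) | apply: (eq_modulo 1 eb)
             | apply: (eq_modulo 1 ec) | apply: (eq_modulo 1 ed)]; ring.
rewrite (mx2_eta g) mx2_zero.
move: (g 0 0) (g 0 1) (g 1 0) (g 1 1) => a b c d Ag.
have [ec ed] := algDer_ltrace Ag; have [ea eb] := algDer_rtrace Ag.
congr mx2; [apply: (eq_modulo 1 ea) | apply: (eq_modulo 1 eb)
           | apply: (eq_modulo 1 ec) | apply: (eq_modulo 1 ed)]; ring.
Qed.

(** After the first row is known, the e1-coordinate of the image of e1 e2 gives
    d = 1; then its e2-coordinate reads c + b2 = b2 - c. *)
Lemma A4_A8_rigid (b1 b2 b3 : F) : b2 = 1 \/ b3 = 1 ->
  algAut (scmx 0 1 1 0 b1 b2 b3 (- 1)) = [set 1%:M] /\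
  algDer (scmx 0 1 1 0 b1 b2 b3 (- 1)) = [set 0].
Proof.
move=> b_eq1; have tr1 : unit_trace 0 1 1 b2 b3 (- 1 : F).
  by rewrite /unit_trace !add0r subrr; case: b_eq1 => ->; [left | right].
split; apply/predeqP => g /=; split=> [|->]; [|exact: algAut1| |exact: algDer0].
  rewrite (mx2_eta g) mx2_scalar1.
  move: (g 0 0) (g 0 1) (g 1 0) (g 1 1) => a b c d Ag.
  have [a_eq1 b_eq0] := algAut_row1 tr1 Ag; rewrite a_eq1 b_eq0 in Ag *.
  move: Ag => /algAut_mx2P[_ [_ [e01 e11] _ _]].
  have d_eq1 : d = 1 by apply: (eq_modulo (- 1) e01); ring.
  rewrite d_eq1 in e11 *; congr mx2; apply: (mulfI two_neq0).
  by apply: (eq_modulo 1 e11); ring.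
rewrite (mx2_eta g) mx2_zero.
move: (g 0 0) (g 0 1) (g 1 0) (g 1 1) => a b c d Ag.
have [a_eq0 b_eq0] := algDer_row0 tr1 Ag; rewrite a_eq0 b_eq0 in Ag *.
move: Ag => /algDer_mx2P[_ [e01 e11] _ _].
have d_eq0 : d = 0 by apply: (eq_modulo (- 1) e01); ring.
rewrite d_eq0 in e11 *; congr mx2; apply: (mulfI two_neq0).
by apply: (eq_modulo 1 e11); ring.
Qed.

End RigidFamilies.

(** * The family A10 *)

Section A10.

Variable F : fieldType.
Hypotheses (two_neq0 : 2 != 0 :> F) (three_neq0 : 3 != 0 :> F).

(** The equations for e2 e1 repeat those for e1 e2, since the algebra is
    commutative. *)
Lemma algAut_A10P (beta1 a b c d : F) :
  algAut (A10 beta1) (mx2 a b c d) <-> a * d - b * c != 0 /\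
  [/\ beta1 * b = c * (2 * a + c) /\ beta1 * d = beta1 * a ^+ 2 - c ^+ 2,
      a = a * d + b * c + c * d /\ c = beta1 * (a * b) - c * d
    & a - b = 2 * (b * d) + d ^+ 2 /\ c - d = beta1 * b ^+ 2 - d ^+ 2].
Proof.
rewrite algAut_mx2P; split=> -[det_neq0].
  move=> [[e00 e10] [e01 e11] _ [e03 e13]]; split=> //; split; split.
  - by apply: (eq_modulo 1 e00); ring.
  - by apply: (eq_modulo 1 e10); ring.
  - by apply: (eq_modulo 1 e01); ring.
  - by apply: (eq_modulo 1 e11); ring.
  - by apply: (eq_modulo 1 e03); ring.
  - by apply: (eq_modulo 1 e13); ring.
move=> [[e00 e10] [e01 e11] [e03 e13]]; split=> //; split; split.
- by apply: (eq_modulo 1 e00); ring.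
- by apply: (eq_modulo 1 e10); ring.
- by apply: (eq_modulo 1 e01); ring.
- by apply: (eq_modulo 1 e11); ring.
- by apply: (eq_modulo 1 e01); ring.
- by apply: (eq_modulo 1 e11); ring.
- by apply: (eq_modulo 1 e03); ring.
- by apply: (eq_modulo 1 e13); ring.
Qed.

Lemma algDer_A10P (beta1 a b c d : F) :
  algDer (A10 beta1) (mx2 a b c d) <->
  [/\ beta1 * b = 2 * c /\ beta1 * d = 2 * a * beta1,
      c + d = 0 /\ 2 * c = beta1 * b
    & a = 3 * b + 2 * d /\ c + d = 0].
Proof.
rewrite algDer_mx2P; split.
  move=> [[e00 e10] [e01 e11] _ [e03 e13]]; split; split.
  - by apply: (eq_modulo 1 e00); ring.
  - by apply: (eq_modulo 1 e10); ring.
  - by apply: (eq_modulo (- 1) e01); ring.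
  - by apply: (eq_modulo 1 e11); ring.
  - by apply: (eq_modulo 1 e03); ring.
  - by apply: (eq_modulo 1 e13); ring.
move=> [[e00 e10] [e01 e11] [e03 e13]]; split; split.
- by apply: (eq_modulo 1 e00); ring.
- by apply: (eq_modulo 1 e10); ring.
- by apply: (eq_modulo (- 1) e01); ring.
- by apply: (eq_modulo 1 e11); ring.
- by apply: (eq_modulo (- 1) e01); ring.
- by apply: (eq_modulo 1 e11); ring.
- by apply: (eq_modulo 1 e03); ring.
- by apply: (eq_modulo 1 e13); ring.
Qed.

(** Eliminating b and c gives a cubic relation between a and d with three
    linear factors.  Two of them are the announced traces, of order 3 and of
    order 2 elements.  The third, d = 2 a - 1, is compatible with the other
    equations only if one of the first two vanishes or beta1 = 4, where the
    discriminant of the cubic form is zero. *)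
Lemma algAut_A10_trace (beta1 a b c d : F) : beta1 != 4 -> c != 0 ->
  algAut (A10 beta1) (mx2 a b c d) -> a + d + 1 = 0 \/ a + d = 0.
Proof.
move=> beta1_neq4 c_neq0.
move=> /algAut_A10P[_ [[e00 e10] [e01 e11] [e03 e13]]].
have e : 1 + d = 2 * a ^+ 2 + a * c.
  apply: (mulfI c_neq0).
  by apply: (eq_modulo 1 e11); apply: (eq_modulo a e00); ring.
have : (a + d + 1) * (a + d) * (2 * a - 1 - d) = 0.
  (* In a (1 + 2 d) e01 the variable c occurs only in a c, which e replaces;
     then b occurs only in b (1 + 2 d), which e03 replaces. *)
  apply: (eq_modulo (a * (1 + 2 * d)) e01).
  apply: (eq_modulo (- ((b + d) * (1 + 2 * d))) e).
  by apply: (eq_modulo (2 * a ^+ 2 - 1 - d) e03); ring.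
move/eqP; rewrite !mulf_eq0 -orbA.
case/or3P=> /eqP e0; [by left | by right | left].
have de : d = 2 * a - 1 by apply: (eq_modulo (- 1) e0); ring.
have : a * (2 - 2 * a - c) = 0.
  by apply: (eq_modulo 1 e); rewrite de; ring.
move/eqP; rewrite mulf_eq0 => /orP[/eqP a0|/eqP ce].
  by rewrite de a0; ring.
exfalso; move/negP: beta1_neq4; apply; apply/eqP.
have be : b = 1 - a.
  apply: (mulfI c_neq0); apply: (eq_modulo (- 1) e01); rewrite de.
  by apply: (eq_modulo a ce); ring.
have a_neq1 : 1 - a != 0.
  apply: contra c_neq0 => /eqP a1; apply/eqP.
  by apply: (eq_modulo (- 1) ce); apply: (eq_modulo 2 a1); ring.
apply: (mulIf a_neq1); rewrite -be e00 be.
have -> : c = 2 - 2 * a by apply: (eq_modulo (- 1) ce); ring.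
ring.
Qed.

(** With a = -1 - d, the first coordinate for e2 e2 gives b (1 + 2 d), and
    (1 + d) (c - 1 - 2 d) = 0 gives c unless d = -1.  In that case b = 1,
    beta1 = c ^ 2 and c is 2 or -1; the value 2 would mean beta1 = 4. *)
Lemma algAut_A10_order3 (beta1 a b c d : F) :
  beta1 != 4 -> c != 0 -> a + d + 1 = 0 ->
  algAut (A10 beta1) (mx2 a b c d) -> S1 beta1 (mx2 a b c d).
Proof.
move=> beta1_neq4 c_neq0 tr.
move=> /algAut_A10P[det_neq0 [[e00 e10] [e01 e11] [e03 e13]]].
have ae : a = - 1 - d by apply: (eq_modulo 1 tr); ring.
have ce : c = 1 + 2 * d.
  have : (1 + d) * (c - (1 + 2 * d)) = 0.
    apply: (mulfI c_neq0); apply: (eq_modulo 1 e11).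
    by apply: (eq_modulo a e00); rewrite ae; ring.
  move/eqP; rewrite mulf_eq0 => /orP[/eqP d1|]; last first.
    by rewrite subr_eq0 => /eqP.
  have de : d = - 1 by apply: (eq_modulo 1 d1); ring.
  have a0 : a = 0 by rewrite ae de; ring.
  have b1 : b = 1 by apply: (eq_modulo 1 e03); rewrite a0 de; ring.
  have betae : beta1 = c ^+ 2 by rewrite -[LHS]mulr1 -b1 e00 a0; ring.
  have : (c - 2) * (c + 1) = 0.
    by apply: (eq_modulo (- 1) e13); rewrite betae b1 de; ring.
  move/eqP; rewrite mulf_eq0 => /orP[/eqP c2|/eqP c1].
    move/eqP: beta1_neq4; case; rewrite betae.
    by apply: (eq_modulo (c + 2) c2); ring.
  by apply: (eq_modulo 1 c1); rewrite de; ring.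
have dd_neq0 : 1 + 2 * d != 0 by rewrite -ce.
have bn : b * (1 + 2 * d) = - (1 + d + d ^+ 2).
  by apply: (eq_modulo (- 1) e03); rewrite ae; ring.
have betab : beta1 * b = - (1 + 2 * d) by rewrite e00 ae ce; ring.
have q_neq0 : d ^+ 2 + d + 1 != 0.
  apply: contra dd_neq0 => /eqP q0; move/eqP: bn.
  have -> : - (1 + d + d ^+ 2) = 0 by apply: (eq_modulo (- 1) q0); ring.
  rewrite mulf_eq0 => /orP[/eqP b0|//].
  by rewrite -oppr_eq0 -betab b0 mulr0.
exists d; split=> //; last first.
  rewrite ae ce; congr mx2; apply: (mulIf dd_neq0); rewrite bn; field.
  exact: dd_neq0.
apply: (mulIf q_neq0); rewrite divfK //.
apply: (eq_modulo beta1 bn).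
by apply: (eq_modulo (- (1 + 2 * d)) betab); ring.
Qed.

(** With a = -d, the equations give d c = 2 d ^ 2 - d - 1 = (d - 1) (1 + 2 d);
    d = 0 is impossible there, and c != 0 makes both factors nonzero. *)
Lemma algAut_A10_order2 (beta1 a b c d : F) : c != 0 -> a + d = 0 ->
  algAut (A10 beta1) (mx2 a b c d) -> S2 beta1 (mx2 a b c d).
Proof.
move=> c_neq0 tr.
move=> /algAut_A10P[det_neq0 [[e00 e10] [e01 e11] [e03 e13]]].
have ae : a = - d by apply: (eq_modulo 1 tr); ring.
have ce : d * c = 2 * d ^+ 2 - d - 1.
  apply: (mulfI c_neq0); apply: (eq_modulo 1 e11).
  by apply: (eq_modulo a e00); rewrite ae; ring.
have d_neq0 : d != 0.
  apply: contra (oner_neq0 F) => /eqP d0; apply/eqP.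
  by apply: (eq_modulo 1 ce); rewrite d0; ring.
have dc_factor : d * c = (d - 1) * (1 + 2 * d) by rewrite ce; ring.
have : (d - 1) * (1 + 2 * d) != 0 by rewrite -dc_factor mulf_neq0.
rewrite mulf_eq0 negb_or => /andP[d1_neq0 dd_neq0].
exists d; split=> //; last first.
  rewrite ae; congr mx2.
    apply: (mulIf dd_neq0); rewrite divfK //.
    by apply: (eq_modulo (- 1) e03); rewrite ae; ring.
  by apply: (mulfI d_neq0); rewrite ce; field.
have betae : beta1 * (d * (d - 1)) = c ^+ 2.
  by apply: (eq_modulo (- 1) e10); rewrite ae; ring.
have cc : c = (d - 1) * (1 + 2 * d) / d.
  by apply: (mulfI d_neq0); rewrite dc_factor; field.
apply: (mulIf (mulf_neq0 d_neq0 d1_neq0)); rewrite betae cc; field.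
exact: d_neq0.
Qed.

(** c = 0 leaves only the identity, because beta1 b = c (2 a + c).  For a
    derivation everything is a multiple of a, and (beta1 - 4) a = 0. *)
Lemma A10_finite (beta1 : F) : beta1 != 0 -> beta1 != 4 ->
  algAut (A10 beta1) = [set 1%:M] `|` S1 beta1 `|` S2 beta1 /\
  algDer (A10 beta1) = [set 0].
Proof.
move=> beta1_neq0 beta1_neq4; split; apply/predeqP => g /=; split.
- rewrite (mx2_eta g) mx2_scalar1.
  move: (g 0 0) (g 0 1) (g 1 0) (g 1 1) => a b c d Ag.
  have [c0|c_neq0] := eqVneq c 0; last first.
    have [tr|tr] := algAut_A10_trace beta1_neq4 c_neq0 Ag.
      by left; right; apply: algAut_A10_order3.
    by right; apply: algAut_A10_order2.
  left; left => /=.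
  move/algAut_A10P: Ag => [det_neq0 [[e00 e10] [e01 e11] [e03 e13]]].
  have b0 : b = 0.
    by apply: (mulfI beta1_neq0); rewrite e00 c0; ring.
  have a_neq0 : a != 0.
    by apply: contra det_neq0 => /eqP ->; rewrite b0; apply/eqP; ring.
  have d1 : d = 1.
    by apply: (mulfI a_neq0); apply: (eq_modulo (- 1) e01); rewrite c0; ring.
  have a1 : a = 1.
    by apply: (eq_modulo 1 e03); rewrite d1 b0; ring.
  by rewrite a1 b0 c0 d1.
- move=> [[->|[d [dd_neq0 q_neq0 -> ->]]]|[d [d_neq0 dd_neq0 -> ->]]].
  + exact: algAut1.
  + apply/algAut_A10P; split.
      rewrite (_ : _ - _ = 1) ?oner_eq0 //; field; exact: dd_neq0.
    by split; split; field; rewrite ?dd_neq0 ?q_neq0.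
  apply/algAut_A10P; split.
    rewrite (_ : _ - _ = - 1) ?oppr_eq0 ?oner_eq0 //; field.
    by rewrite dd_neq0 d_neq0.
  by split; split; field; rewrite ?dd_neq0 ?d_neq0.
- rewrite (mx2_eta g) mx2_zero.
  move: (g 0 0) (g 0 1) (g 1 0) (g 1 1) => a b c d.
  move/algDer_A10P => [[e00 e10] [e01 _] [e03 _]].
  have de : d = 2 * a by apply: (mulfI beta1_neq0); rewrite e10; ring.
  have be : b = - a.
    apply: (mulfI three_neq0); apply: (eq_modulo (- 1) e03); rewrite de; ring.
  have ce : c = - 2 * a by apply: (eq_modulo 1 e01); rewrite de; ring.
  have beta4_neq0 : beta1 - 4 != 0 by rewrite subr_eq0.
  have a0 : a = 0.
    apply: (mulfI beta4_neq0); apply: (eq_modulo (- 1) e00).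
    by rewrite be ce; ring.
  by rewrite de be ce a0 mulr0 mulr0 oppr0.
by move=> ->; apply: algDer0.
Qed.

(** For beta1 = 0 the cubic form is - y ^ 2 (3 x + y): it has a double root,
    whence c = 0, and a one-parameter group of symmetries. *)
Lemma A10_zero :
  algAut (A10 (0 : F)) =
    [set g | exists a, 3 * a + 1 != 0 /\ g = mx2 (3 * a + 1) a 0 1] /\
  algDer (A10 (0 : F)) = [set D | exists a, D = mx2 (3 * a) a 0 0].
Proof.
split; apply/predeqP => g /=; split.
- rewrite (mx2_eta g); move: (g 0 0) (g 0 1) (g 1 0) (g 1 1) => a b c d.
  move/algAut_A10P => [det_neq0 [[e00 e10] [e01 e11] [e03 e13]]].
  have /eqP : c ^+ 2 = 0 by apply: (eq_modulo 1 e10); ring.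
  rewrite sqrf_eq0 => /eqP c0.
  have a_neq0 : a != 0.
    by apply: contra det_neq0 => /eqP ->; rewrite c0; apply/eqP; ring.
  have d1 : d = 1.
    by apply: (mulfI a_neq0); apply: (eq_modulo (- 1) e01); rewrite c0; ring.
  have ae : a = 3 * b + 1 by apply: (eq_modulo 1 e03); rewrite d1; ring.
  by exists b; split; rewrite -?ae ?c0 ?d1.
- move=> [a [a_neq0 ->]]; apply/algAut_A10P; split.
    by rewrite mulr1 mulr0 subr0.
  by split; split; ring.
- rewrite (mx2_eta g); move: (g 0 0) (g 0 1) (g 1 0) (g 1 1) => a b c d.
  move/algDer_A10P => [[e00 _] [e01 _] [e03 _]].
  have c0 : c = 0 by apply: (mulfI two_neq0); rewrite -e00; ring.
  have d0 : d = 0 by rewrite c0 add0r in e01.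
  by exists b; rewrite e03 c0 d0 mulr0 addr0.
by move=> [a ->]; apply/algDer_A10P; split; split; ring.
Qed.

End A10.

(** * The family A11 *)

Section A11.

Variable F : fieldType.
Hypothesis three_neq0 : 3 != 0 :> F.

Lemma algAut_A11P (beta1 a b c d : F) :
  algAut (A11 beta1) (mx2 a b c d) <-> a * d - b * c != 0 /\
  [/\ beta1 * b = c ^+ 2 /\ beta1 * d = beta1 * a ^+ 2,
      c * d = 0 /\ beta1 * (a * b) = 0
    & a = d ^+ 2 /\ c = beta1 * b ^+ 2].
Proof.
rewrite algAut_mx2P; split=> -[det_neq0].
  move=> [[e00 e10] [e01 e11] _ [e03 e13]]; split=> //; split; split.
  - by apply: (eq_modulo 1 e00); ring.
  - by apply: (eq_modulo 1 e10); ring.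
  - by apply: (eq_modulo (- 1) e01); ring.
  - by apply: (eq_modulo (- 1) e11); ring.
  - by apply: (eq_modulo 1 e03); ring.
  - by apply: (eq_modulo 1 e13); ring.
move=> [[e00 e10] [e01 e11] [e03 e13]]; split=> //; split; split.
- by apply: (eq_modulo 1 e00); ring.
- by apply: (eq_modulo 1 e10); ring.
- by apply: (eq_modulo (- 1) e01); ring.
- by apply: (eq_modulo (- 1) e11); ring.
- by apply: (eq_modulo (- 1) e01); ring.
- by apply: (eq_modulo (- 1) e11); ring.
- by apply: (eq_modulo 1 e03); ring.
- by apply: (eq_modulo 1 e13); ring.
Qed.

Lemma algDer_A11P (beta1 a b c d : F) :
  algDer (A11 beta1) (mx2 a b c d) <->
  [/\ beta1 * b = 0, beta1 * d = 2 * a * beta1, c = 0 & a = 2 * d].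
Proof.
rewrite algDer_mx2P; split.
  move=> [[e00 e10] [e01 e11] _ [e03 e13]]; split.
  - by apply: (eq_modulo 1 e00); ring.
  - by apply: (eq_modulo 1 e10); ring.
  - by apply: (eq_modulo (- 1) e01); ring.
  - by apply: (eq_modulo 1 e03); ring.
move=> [e00 e10 -> ae]; rewrite ae in e10 *; split; split; try ring.
- by apply: (eq_modulo 1 e00); ring.
- by apply: (eq_modulo 1 e10); ring.
- by apply: (eq_modulo (- 1) e00); ring.
- by apply: (eq_modulo (- 1) e00); ring.
Qed.

(** Since e1 e2 = 0, an automorphism sends e1 and e2 to vectors with zero
    product, so a b = 0: it preserves both axes or exchanges them. *)
Lemma A11_finite (beta1 : F) : beta1 != 0 ->
  algAut (A11 beta1) =
    [set g | exists a, a ^+ 3 = 1 /\ g = mx2 a 0 0 (a ^+ 2)] `|`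
    [set g | exists b, [/\ b != 0, b ^- 3 = beta1 & g = mx2 0 b (1 / b) 0]] /\
  algDer (A11 beta1) = [set 0].
Proof.
move=> beta1_neq0; split; apply/predeqP => g /=; split.
- rewrite (mx2_eta g); move: (g 0 0) (g 0 1) (g 1 0) (g 1 1) => a b c d.
  move/algAut_A11P => [det_neq0 [[e00 e10] [e01 e11] [e03 e13]]].
  move/eqP: e11; rewrite !mulf_eq0 (negPf beta1_neq0) /=.
  have de := mulfI beta1_neq0 e10.
  case/orP=> /eqP z; [right | left].
    have b_neq0 : b != 0.
      apply: contra det_neq0 => /eqP ->; rewrite z; apply/eqP; ring.
    have c_neq0 : c != 0.
      apply: contra det_neq0 => /eqP ->; rewrite z; apply/eqP; ring.
    have bc : b * c = 1.
      apply: (mulfI c_neq0); rewrite mulr1 [RHS]e13.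
      apply: (eq_modulo (- b) e00); ring.
    have ce : c = 1 / b by apply: (mulfI b_neq0); rewrite bc; field.
    exists b; split=> //; last by rewrite de z expr0n /= ce.
    by apply: (mulfI (expf_neq0 2 b_neq0)); rewrite [RHS]mulrC -e13 ce; field.
  have c0 : c = 0 by rewrite e13 z; ring.
  have a_neq0 : a != 0.
    by apply: contra det_neq0 => /eqP ->; rewrite z; apply/eqP; ring.
  exists a; split; last by rewrite z c0 -de.
  apply: (mulfI a_neq0); rewrite mulr1 [RHS]e03 de; ring.
- move=> [[a [a3 ->]]|[b [b_neq0 <- ->]]]; apply/algAut_A11P.
    split; first by rewrite mulr0 subr0 -exprS a3 oner_eq0.
    split; split; try ring.
    by apply: (eq_modulo (- a) a3); ring.
  split.
    by rewrite (_ : _ - _ = - 1) ?oppr_eq0 ?oner_eq0 //; field.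
  by split; split; field.
- rewrite (mx2_eta g) mx2_zero.
  move: (g 0 0) (g 0 1) (g 1 0) (g 1 1) => a b c d.
  move/algDer_A11P => [e00 e10 c0 ae].
  have de : d = 2 * a by apply: (mulfI beta1_neq0); rewrite e10; ring.
  have b0 : b = 0 by apply: (mulfI beta1_neq0); rewrite e00 mulr0.
  have a0 : a = 0.
    by apply: (mulfI three_neq0); apply: (eq_modulo (- 1) ae); rewrite de; ring.
  by rewrite c0 b0 de a0 mulr0.
by move=> ->; apply: algDer0.
Qed.

Lemma A11_zero :
  algAut (A11 (0 : F)) =
    [set g | exists a b, a != 0 /\ g = mx2 (a ^+ 2) b 0 a] /\
  algDer (A11 (0 : F)) = [set D | exists a b, D = mx2 (2 * a) b 0 a].
Proof.
split; apply/predeqP => g /=; split.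
- rewrite (mx2_eta g); move: (g 0 0) (g 0 1) (g 1 0) (g 1 1) => a b c d.
  move/algAut_A11P => [det_neq0 [_ _ [e03 e13]]].
  have c0 : c = 0 by rewrite e13 mul0r.
  exists d, b; split; last by rewrite c0 e03.
  by apply: contra det_neq0 => /eqP ->; rewrite c0; apply/eqP; ring.
- move=> [a [b [a_neq0 ->]]]; apply/algAut_A11P; split.
    by rewrite mulr0 subr0 -exprSr expf_neq0.
  by split; split; ring.
- rewrite (mx2_eta g); move: (g 0 0) (g 0 1) (g 1 0) (g 1 1) => a b c d.
  by move/algDer_A11P => [_ _ -> ->]; exists d, b.
by move=> [a [b ->]]; apply/algDer_A11P; split; ring.
Qed.

End A11.

(** * The family A12 *)

Section A12.

Variable F : fieldType.
Hypotheses (two_neq0 : 2 != 0 :> F) (three_neq0 : 3 != 0 :> F).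

Lemma algAut_A12P (beta1 a b c d : F) :
  algAut (A12 beta1) (mx2 a b c d) <-> a * d - b * c != 0 /\
  [/\ beta1 * b = 2 * (a * c) /\ beta1 * d = beta1 * a ^+ 2 - c ^+ 2,
      a = a * d + b * c /\ c = beta1 * (a * b) - c * d
    & b * (1 + 2 * d) = 0 /\ d ^+ 2 - d = beta1 * b ^+ 2].
Proof.
rewrite algAut_mx2P; split=> -[det_neq0].
  move=> [[e00 e10] [e01 e11] _ [e03 e13]]; split=> //; split; split.
  - by apply: (eq_modulo 1 e00); ring.
  - by apply: (eq_modulo 1 e10); ring.
  - by apply: (eq_modulo 1 e01); ring.
  - by apply: (eq_modulo 1 e11); ring.
  - by apply: (eq_modulo (- 1) e03); ring.
  - by apply: (eq_modulo 1 e13); ring.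
move=> [[e00 e10] [e01 e11] [e03 e13]]; split=> //; split; split.
- by apply: (eq_modulo 1 e00); ring.
- by apply: (eq_modulo 1 e10); ring.
- by apply: (eq_modulo 1 e01); ring.
- by apply: (eq_modulo 1 e11); ring.
- by apply: (eq_modulo 1 e01); ring.
- by apply: (eq_modulo 1 e11); ring.
- by apply: (eq_modulo (- 1) e03); ring.
- by apply: (eq_modulo 1 e13); ring.
Qed.

Lemma algDer_A12P (beta1 a b c d : F) :
  algDer (A12 beta1) (mx2 a b c d) <->
  [/\ beta1 * a = 0, b = 0, c = 0 & d = 0].
Proof.
rewrite algDer_mx2P; split; last first.
  move=> [e -> -> ->]; split; split; try ring.
  by apply: (eq_modulo (- 2) e); ring.
move=> [[e00 e10] [e01 e11] _ [e03 e13]].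
have d0 : d = 0 by apply: (eq_modulo (- 1) e01); ring.
have b0 : b = 0.
  apply: (mulfI three_neq0); apply: (eq_modulo (- 1) e03); rewrite d0; ring.
have c0 : c = 0.
  apply: (mulfI two_neq0); apply: (eq_modulo (- 1) e00); rewrite b0; ring.
split=> //; apply: (mulfI two_neq0); apply: (eq_modulo (- 1) e10).
by rewrite d0 c0; ring.
Qed.

(** The first coordinate for e2 e2 = - e2 is b (1 + 2 d) = 0.  If b = 0 the
    matrix is diagonal; otherwise d = -1/2, and the equations give
    4 beta1 b ^ 2 = 3 and (2 a) ^ 2 = 1, so that eps is 2 a. *)
Lemma A12_finite (beta1 : F) : beta1 != 0 ->
  algAut (A12 beta1) =
    [set mx2 1 0 0 1; mx2 (- 1) 0 0 1] `|`
    [set g | exists eps b,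
       [/\ eps = 1 \/ eps = - 1, b != 0, beta1 = 3 / (4 * b ^+ 2)
         & g = mx2 (eps / 2) b (3 * eps / (4 * b)) (- (1 / 2))]] /\
  algDer (A12 beta1) = [set 0].
Proof.
have four_neq0 : 4 != 0 :> F.
  by rewrite (_ : 4 = 2 * 2) ?mulf_neq0 //; ring.
move=> beta1_neq0; split; apply/predeqP => g /=; split.
- rewrite (mx2_eta g); move: (g 0 0) (g 0 1) (g 1 0) (g 1 1) => a b c d.
  move/algAut_A12P => [det_neq0 [[e00 e10] [e01 e11] [e03 e13]]].
  have [b0|b_neq0] := eqVneq b 0.
    left; have a_neq0 : a != 0.
      by apply: contra det_neq0 => /eqP ->; rewrite b0; apply/eqP; ring.
    have d1 : d = 1.
      by apply: (mulfI a_neq0); apply: (eq_modulo (- 1) e01); rewrite b0; ring.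
    have c0 : c = 0.
      apply: (mulfI two_neq0); apply: (mulfI a_neq0).
      by apply: (eq_modulo (- 1) e00); rewrite b0; ring.
    have : beta1 * (a ^+ 2 - 1) = 0.
      by apply: (eq_modulo (- 1) e10); rewrite c0 d1; ring.
    move/eqP; rewrite mulf_eq0 (negPf beta1_neq0) /= subr_eq0 sqrf_eq1.
    by rewrite b0 c0 d1 => /orP[] /eqP ->; [left | right].
  right; have de : d = - (1 / 2).
    move/eqP: e03; rewrite mulf_eq0 (negPf b_neq0) /= => /eqP dd.
    by apply: (mulfI two_neq0); apply: (eq_modulo 1 dd); field.
  have bc : 2 * (b * c) = 3 * a.
    by apply: (eq_modulo (- 2) e01); rewrite de; field.
  have bb : 4 * (beta1 * b ^+ 2) = 3 by rewrite -e13 de; field.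
  have : (2 * a) ^+ 2 = 1.
    apply: (mulfI three_neq0); rewrite mulr1 -[RHS]bb.
    by apply: (eq_modulo (- 4 * a) bc); apply: (eq_modulo (- 4 * b) e00); ring.
  move/eqP; rewrite sqrf_eq1 => a_eq.
  exists (2 * a), b; split=> //.
  + by case/orP: a_eq => /eqP; [left | right].
  + apply: (mulIf (mulf_neq0 four_neq0 (expf_neq0 2 b_neq0))).
    by rewrite divfK ?mulf_neq0 ?expf_neq0 //; apply: (eq_modulo 1 bb); ring.
  congr mx2 => //; first by field.
  apply: (mulfI (mulf_neq0 two_neq0 b_neq0)); rewrite -mulrA bc.
  by field; rewrite b_neq0.
- move=> [[] ->|[eps [b [epsP b_neq0 -> ->]]]]; apply/algAut_A12P.
  + split; first by rewrite mulr1 mulr0 subr0 oner_eq0.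
    by split; split; ring.
  + split; first by rewrite mulr1 mulr0 subr0 oppr_eq0 oner_eq0.
    by split; split; ring.
  have eps_neq0 : eps != 0 by case: epsP => ->; rewrite ?oppr_eq0 oner_eq0.
  split.
    rewrite (_ : _ - _ = - eps) ?oppr_eq0 //; field.
    by rewrite b_neq0 four_neq0 two_neq0.
  by case: epsP => ->; split; split; field;
    rewrite ?b_neq0 ?four_neq0 ?two_neq0.
- rewrite (mx2_eta g) mx2_zero.
  move: (g 0 0) (g 0 1) (g 1 0) (g 1 1) => a b c d.
  move/algDer_A12P => [e -> -> ->]; congr mx2.
  by apply: (mulfI beta1_neq0); rewrite e mulr0.
by move=> ->; apply: algDer0.
Qed.

Lemma A12_zero :
  algAut (A12 (0 : F)) = [set g | exists a, a != 0 /\ g = mx2 a 0 0 1] /\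
  algDer (A12 (0 : F)) = [set D | exists a, D = mx2 a 0 0 0].
Proof.
split; apply/predeqP => g /=; split.
- rewrite (mx2_eta g); move: (g 0 0) (g 0 1) (g 1 0) (g 1 1) => a b c d.
  move/algAut_A12P => [det_neq0 [[_ e10] _ [e03 e13]]].
  have /eqP : c ^+ 2 = 0 by apply: (eq_modulo 1 e10); ring.
  rewrite sqrf_eq0 => /eqP c0.
  have : a * d != 0 by move: det_neq0; rewrite c0 mulr0 subr0.
  rewrite mulf_eq0 negb_or => /andP[a_neq0 d_neq0].
  have d1 : d = 1.
    by apply: (mulfI d_neq0); apply: (eq_modulo 1 e13); ring.
  have b0 : b = 0.
    by apply: (mulfI three_neq0); apply: (eq_modulo 1 e03); rewrite d1; ring.
  by exists a; rewrite b0 c0 d1.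
- move=> [a [a_neq0 ->]]; apply/algAut_A12P; split.
    by rewrite mulr1 mulr0 subr0.
  by split; split; ring.
- rewrite (mx2_eta g); move: (g 0 0) (g 0 1) (g 1 0) (g 1 1) => a b c d.
  by move/algDer_A12P => [_ -> -> ->]; exists a.
by move=> [a ->]; apply/algDer_A12P; rewrite mul0r.
Qed.

End A12.

(** * The twelve families together *)

Unset Implicit Arguments.

Theorem theorem3p1 (F : fieldType)
    (char2 : 2%N \notin [pchar F]) (char3 : 3%N \notin [pchar F]) :
  (* 1 *)
  (forall alpha1 alpha2 alpha4 beta1 : F,
     algAut (A1 alpha1 alpha2 alpha4 beta1) = [set 1%:M] /\
     algDer (A1 alpha1 alpha2 alpha4 beta1) = [set 0]) /\
  (* 2 *)
  (forall alpha1 alpha4 beta2 : F, alpha4 != 0 ->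
     algAut (A2 alpha1 alpha4 beta2) = [set 1%:M] /\
     algDer (A2 alpha1 alpha4 beta2) = [set 0]) /\
  (* 3 *)
  ((forall alpha1 alpha4 beta2 : F, alpha4 != 0 ->
      algAut (A3 alpha1 alpha4 beta2) = [set mx2 1 0 0 1; mx2 1 0 0 (- 1)] /\
      algDer (A3 alpha1 alpha4 beta2) = [set 0]) /\
   (forall alpha1 beta2 : F, beta2 != 2 * alpha1 - 1 ->
      algAut (A3 alpha1 0 beta2) =
        [set g | exists d : F, d != 0 /\ g = mx2 1 0 0 d] /\
      algDer (A3 alpha1 0 beta2) =
        [set D | exists d : F, D = mx2 0 0 0 d]) /\
   (forall alpha1 : F,
      algAut (A3 alpha1 0 (2 * alpha1 - 1)) =
        [set g | exists c d : F, d != 0 /\ g = mx2 1 0 c d] /\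
      algDer (A3 alpha1 0 (2 * alpha1 - 1)) =
        [set D | exists c d : F, D = mx2 0 0 c d])) /\
  (* 4 *)
  (forall beta1 beta2 : F,
     algAut (A4 beta1 beta2) = [set 1%:M] /\
     algDer (A4 beta1 beta2) = [set 0]) /\
  (* 5 *)
  (forall alpha1 : F,
     algAut (A5 alpha1) = [set g | exists c : F, g = mx2 1 0 c 1] /\
     algDer (A5 alpha1) = [set D | exists c : F, D = mx2 0 0 c 0]) /\
  (* 6 *)
  (forall alpha1 alpha4 : F, alpha4 != 0 ->
     algAut (A6 alpha1 alpha4) = [set 1%:M] /\
     algDer (A6 alpha1 alpha4) = [set 0]) /\
  (* 7 *)
  ((forall alpha1 alpha4 : F, alpha4 != 0 ->
      algAut (A7 alpha1 alpha4) = [set mx2 1 0 0 1; mx2 1 0 0 (- 1)] /\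
      algDer (A7 alpha1 alpha4) = [set 0]) /\
   (forall alpha1 : F, alpha1 != 1 / 3 ->
      algAut (A7 alpha1 0) =
        [set g | exists d : F, d != 0 /\ g = mx2 1 0 0 d] /\
      algDer (A7 alpha1 0) =
        [set D | exists d : F, D = mx2 0 0 0 d]) /\
   (algAut (A7 (1 / 3 : F) 0) =
      [set g | exists c d : F, d != 0 /\ g = mx2 1 0 c d] /\
    algDer (A7 (1 / 3 : F) 0) =
      [set D | exists c d : F, D = mx2 0 0 c d])) /\
  (* 8 *)
  (forall beta1 : F,
     algAut (A8 beta1) = [set 1%:M] /\
     algDer (A8 beta1) = [set 0]) /\
  (* 9 *)
  (algAut (A9 F) = [set g | exists c : F, g = mx2 1 0 c 1] /\
   algDer (A9 F) = [set D | exists c : F, D = mx2 0 0 c 0]) /\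
  (* 10 *)
  ((forall beta1 : F, beta1 != 0 -> beta1 != 4 ->
      algAut (A10 beta1) = [set 1%:M] `|` S1 beta1 `|` S2 beta1 /\
      algDer (A10 beta1) = [set 0]) /\
   (algAut (A10 (0 : F)) =
      [set g | exists a : F, 3 * a + 1 != 0 /\ g = mx2 (3 * a + 1) a 0 1] /\
    algDer (A10 (0 : F)) =
      [set D | exists a : F, D = mx2 (3 * a) a 0 0])) /\
  (* 11 *)
  ((forall beta1 : F, beta1 != 0 ->
      algAut (A11 beta1) =
        [set g | exists a : F, a ^+ 3 = 1 /\ g = mx2 a 0 0 (a ^+ 2)] `|`
        [set g | exists b : F,
           [/\ b != 0, b ^- 3 = beta1 & g = mx2 0 b (1 / b) 0]] /\
      algDer (A11 beta1) = [set 0]) /\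
   (algAut (A11 (0 : F)) =
      [set g | exists a b : F, a != 0 /\ g = mx2 (a ^+ 2) b 0 a] /\
    algDer (A11 (0 : F)) =
      [set D | exists a b : F, D = mx2 (2 * a) b 0 a])) /\
  (* 12 *)
  ((forall beta1 : F, beta1 != 0 ->
      algAut (A12 beta1) =
        [set mx2 1 0 0 1; mx2 (- 1) 0 0 1] `|`
        [set g | exists eps b : F,
           [/\ eps = 1 \/ eps = - 1, b != 0, beta1 = 3 / (4 * b ^+ 2)
             & g = mx2 (eps / 2) b (3 * eps / (4 * b)) (- (1 / 2))]] /\
      algDer (A12 beta1) = [set 0]) /\
   (algAut (A12 (0 : F)) =
      [set g | exists a : F, a != 0 /\ g = mx2 a 0 0 1] /\
    algDer (A12 (0 : F)) =
      [set D | exists a : F, D = mx2 a 0 0 0])).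
Proof.
have two_neq0 : 2 != 0 :> F by apply: natr_neq0.
have three_neq0 : 3 != 0 :> F by apply: natr_neq0.
(* One trace form has first coefficient 1: the right one in A2, A3 and A5, the
   left one in A6 and A7. *)
have tr_r (x y : F) : x + y = 1 \/ x + (1 - x) = 1.
  by right; rewrite addrC subrK.
have tr_l (x y : F) : x + (1 - x) = 1 \/ x + y = 1.
  by left; rewrite addrC subrK.
split; first exact: A1_rigid.
split=> [a1 a4 b2 a4_neq0|]; first exact: eigen_rigid.
split.
  split=> [a1 a4 b2 a4_neq0|]; first exact: eigen_reflection.
  split=> [a1 b2 b2_neq|a1].
    apply: eigen_torus => //; apply: contra b2_neq => /eqP e; apply/eqP.
    by apply: (eq_modulo 1 e); ring.
  by apply: eigen_affine => //; ring.
split=> [b1 b2|]; first by apply: A4_A8_rigid => //; right.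
split=> [a1|]; first by apply: eigen_unipotent => //; ring.
split=> [a1 a4 a4_neq0|]; first exact: eigen_rigid.
split.
  split=> [a1 a4 a4_neq0|]; first exact: eigen_reflection.
  split=> [a1 a1_neq|].
    apply: eigen_torus => //; apply: contra a1_neq => /eqP e; apply/eqP.
    by apply: (mulfI three_neq0); apply: (eq_modulo (- 1) e); field.
  by apply: eigen_affine => //; field.
split=> [b1|]; first by apply: A4_A8_rigid => //; left.
split; first by apply: eigen_unipotent => //; [left | ]; field.
split; first by split; [exact: A10_finite | exact: A10_zero].
split; first by split; [exact: A11_finite | exact: A11_zero].
by split; [exact: A12_finite | exact: A12_zero].
Qed.
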